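(* Let $P\in\mathbb{C}[z]$ be a polynomial with $|P(0)|=1$. Then $\log\|P\|_0 \leq \log^2 M(P)$, where $\log^2 M(P)$ denotes $(\log M(P))^2$.
   Context: For a nonzero polynomial $P\in\mathbb{C}[z]$, the (logarithmic) Mahler measure is $\log M(P)=\frac{1}{2\pi}\int_0^{2\pi}\log|P(e^{it})|\,dt$, and the areal Mahler measure is defined by $\log\|P\|_0=\frac{1}{\pi}\iint_{D}\log|P(z)|\,dA$, where $D$ is the open unit disk in $\mathbb{C}$ and $dA$ is area measure. *)

(* Defs.v *)
From HB Require Import structures.
From mathcomp Require Import all_boot all_order all_algebra.
From mathcomp Require Import complex.
From mathcomp Require Import all_classical all_reals all_analysis.

Set Implicit Arguments.
Unset Strict Implicit.
Unset Printing Implicit Defensive.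

Import Order.TTheory GRing.Theory Num.Theory.
Import numFieldNormedType.Exports.

Local Open Scope classical_set_scope.
Local Open Scope complex_scope.
Local Open Scope ring_scope.

Section mahler.
Context {R : realType}.

(* The norm `|z| on R[i] takes its values in R[i]; it is the image of this real
   number: `|z| = (modulus z)%:C. *)
Definition modulus (z : R[i]) : R := ComplexField.Normc.normc z.

Definition expi (t : R) : R[i] := cos t +i* sin t.

(* C is identified with R * R, on which area measure is the product of the two
   Lebesgue measures. *)
Definition unit_disk : set (R * R) :=
  [set p | modulus (p.1 +i* p.2) < 1].

(* In the two definitions below P is meant to be nonzero. Then log|P| is
   Lebesgue integrable on the circle and on the disk, and the convention
   ln 0 = 0 only affects the finitely many zeros of P, a null set. *)

Definition log_mahler (P : {poly R[i]}) : R :=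
  (2 * pi)^-1 *
  \int[@lebesgue_measure R]_(t in `[0, 2 * pi]) ln (modulus P.[expi t]).

Definition log_areal_mahler (P : {poly R[i]}) : R :=
  pi^-1 *
  \int[(@lebesgue_measure R \x @lebesgue_measure R)%E]_(p in unit_disk)
    ln (modulus P.[p.1 +i* p.2]).

End mahler.

(* Main.v *)
Require Import Defs.
From HB Require Import structures.
From mathcomp Require Import all_boot all_order all_algebra.
From mathcomp Require Import complex.
From mathcomp Require Import all_classical all_reals all_analysis.
From mathcomp Require Import measurable_realfun ring lra.

(** Since [|P(0)| = 1], [log|P(z)|] is the sum of the [log|1 - w z|] over the
    inverses [w] of the roots of [P].  By Jensen's formula the mean of
    [log|1 - w z|] over the unit circle is [u = log^+ |w|].  Area being invariant
    under rotations, the integral of [log|1 - w z|] over the unit disk is that of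
    its circular means [log^+ (|w| |z|)]; writing the latter as the length of
    [{t >= 0 | t < log^+ (|w| |z|)}] and exchanging the integrals bounds it by
    [int_0^u pi (1 - e^(2(t - u))) dt <= int_0^u 2 pi (u - t) dt = pi u^2].
    Hence [log ||P||_0 <= sum u^2 <= (sum u)^2 = (log M(P))^2].

    Jensen's formula for [|z| < 1] comes from the identity
    [(1 - z)(1 + z) = 1 - z^2], which halves the interval of integration while
    keeping the integrand bounded and the integral unchanged; for [|z| = 1] it
    follows by monotone convergence from smaller radii, and for [|z| > 1] from
    the reflection of [z] in the unit circle. *)

Set Implicit Arguments.
Unset Strict Implicit.
Unset Printing Implicit Defensive.

Import Order.TTheory GRing.Theory Num.Theory.
Import numFieldNormedType.Exports.
Local Open Scope classical_set_scope.
Local Open Scope ring_scope.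

Local Notation Re := complex.Re.
Local Notation Im := complex.Im.
Local Arguments modulus : simpl never.

(** * Invariance of area under rotations *)

Section area_invariance.
Context {R : realType}.
Local Notation mu := (@lebesgue_measure R).
Local Notation mu2 := (mu \x mu)%E.
Local Open Scope ereal_scope.

Lemma measurable_shift (a : R) :
  measurable_fun [set: measurableTypeR R] (fun x : R => (x + a)%R : measurableTypeR R).
Proof. by apply: measurable_funD => //; exact: measurable_id. Qed.

(** Lebesgue measure is determined by its values on half-open intervals, whose length is preserved
    by translations. *)
Lemma lebesgue_measure_shift (a : R) (A : set R) : measurable A ->
  pushforward mu (fun x : R => (x + a)%R : measurableTypeR R) A = mu A.
Proof.
move=> mA.
have mphi := measurable_shift a.
apply/esym; move: A mA.
pose mphi_mixin := isMeasurableFun.Build _ _ _ _ _ mphi.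
pose phi : {mfun measurableTypeR R >-> measurableTypeR R} := HB.pack (fun x : R => (x + a)%R : measurableTypeR R) mphi_mixin.
apply: (@lebesgue_measure_unique R (pushforward mu phi)).
move=> _ [[b c]] _ <- /=.
rewrite /pushforward /=.
have -> : (fun x : R => (x + a)%R) @^-1` `]b, c] = `](b - a)%R, (c - a)%R]%classic.
  by apply/seteqP; split => x /=; rewrite !in_itv/= ltrBlDr lerBrDr.
rewrite !lebesgue_measure_itv/= !lte_fin ltrD2r.
by case: ifP => // _; rewrite -!EFinD; congr (_%:E); lra.
Qed.

Lemma ge0_integral_shift (a : R) (f : R -> \bar R) : measurable_fun setT f ->
  (forall x, 0 <= f x) -> \int[mu]_x f (x + a)%R = \int[mu]_x f x.
Proof.
move=> mf f0; have mphi := measurable_shift a.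
rewrite [RHS](eq_measure_integral (pushforward mu (fun x : R => (x + a)%R : measurableTypeR R))).
  by rewrite ge0_integral_pushforward//= preimage_setT.
by move=> A mA _ /=; rewrite lebesgue_measure_shift.
Qed.

(** By Tonelli the first coordinate may be integrated first; for a fixed second coordinate the shear
    is a translation of it. *)
Lemma ge0_integral_shear1 (a : R) (f : R * R -> \bar R) : measurable_fun setT f ->
  (forall x, 0 <= f x) ->
  \int[mu2]_p f (p.1 + a * p.2, p.2)%R = \int[mu2]_p f p.
Proof.
move=> mf f0.
rewrite !fubini_tonelli2//=; last first.
  apply: (measurableT_comp mf); apply: measurable_fun_pair => //=.
  apply: measurable_funD => //.
  by apply: measurable_funM => //; exact: measurable_cst.
apply: eq_integral => y _; rewrite /fubini_G/=.
rewrite (@ge0_integral_shift (a * y)%R (fun x => f (x, y)))//.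
exact: measurableT_comp mf (measurable_pair2 _).
Qed.

Lemma ge0_integral_shear2 (a : R) (f : R * R -> \bar R) : measurable_fun setT f ->
  (forall x, 0 <= f x) ->
  \int[mu2]_p f (p.1, p.2 + a * p.1)%R = \int[mu2]_p f p.
Proof.
move=> mf f0.
rewrite !fubini_tonelli1//=; last first.
  apply: (measurableT_comp mf); apply: measurable_fun_pair => //=.
  apply: measurable_funD => //.
  by apply: measurable_funM => //; exact: measurable_cst.
apply: eq_integral => x _; rewrite /fubini_F/=.
rewrite (@ge0_integral_shift (a * x)%R (fun y => f (x, y)))//.
exact: measurableT_comp mf (measurable_pair1 _).
Qed.

Definition rot (c s : R) (p : R * R) : R * R :=
  (c * p.1 - s * p.2, s * p.1 + c * p.2)%R.

Lemma measurable_rot (c s : R) :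
  measurable_fun [set: measurableTypeR R * measurableTypeR R]
    (rot c s : _ -> measurableTypeR R * measurableTypeR R).
Proof.
apply: measurable_fun_pair => /=.
  by apply: measurable_funB; apply: measurable_funM => //; exact: measurable_cst.
by apply: measurable_funD; apply: measurable_funM => //; exact: measurable_cst.
Qed.

(* A rotation with [s != 0] is a product of three shears. *)
Lemma ge0_integral_rot_neq0 (c s : R) (f : R * R -> \bar R) :
  (c ^+ 2 + s ^+ 2 = 1)%R -> (s != 0)%R -> measurable_fun setT f ->
  (forall x, 0 <= f x) ->
  \int[mu2]_p f (rot c s p) = \int[mu2]_p f p.
Proof.
move=> cs s0 mf f0.
(* For a rotation by [theta] this is [- tan (theta / 2)]: the shears along the first, second and
   first coordinate have coefficients [a], [s], [a], and composing them forces [1 + a s = c]. *)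
pose a := ((c - 1) / s)%R.
have ms1 b : measurable_fun [set: measurableTypeR R * measurableTypeR R]
    (fun p => (p.1 + b * p.2, p.2)%R : measurableTypeR R * measurableTypeR R).
  apply: measurable_fun_pair => //=; apply: measurable_funD => //.
  by apply: measurable_funM => //; exact: measurable_cst.
have ms2 b : measurable_fun [set: measurableTypeR R * measurableTypeR R]
    (fun p => (p.1, p.2 + b * p.1)%R : measurableTypeR R * measurableTypeR R).
  apply: measurable_fun_pair => //=; apply: measurable_funD => //.
  by apply: measurable_funM => //; exact: measurable_cst.
rewrite -(@ge0_integral_shear1 a f)//.
rewrite -(@ge0_integral_shear2 s (fun p => f (p.1 + a * p.2, p.2)%R))//=; last first.
  exact: measurableT_comp mf (ms1 a).
rewrite -(@ge0_integral_shear1 a (fun p => f (p.1 + a * (p.2 + s * p.1), p.2 + s * p.1)%R))//=; last first.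
  exact: measurableT_comp (measurableT_comp mf (ms1 a)) (ms2 s).
apply: eq_integral => -[x y] _; rewrite /rot/=; congr (f (_, _)).
- have as' : (a * s = c - 1)%R by rewrite /a divfK.
  have -> : (x + a * y + a * (y + s * (x + a * y)) =
    x + a * y + a * y + (a * s) * (x + a * y))%R by ring.
  rewrite as'.
  have -> : (x + a * y + a * y + (c - 1) * (x + a * y) = c * x + (a * (1 + c)) * y)%R by ring.
  have -> : (a * (1 + c) = - s)%R; last by ring.
  apply: (mulfI s0); rewrite mulrA [(s * a)%R]mulrC as'.
  by rewrite -[in RHS](mulN1r s) mulrCA -expr2; move: cs; rewrite mulN1r; lra.
- have as' : (s * a = c - 1)%R by rewrite /a mulrC divfK.
  rewrite mulrDr mulrA as'; ring.
Qed.

Lemma ge0_integral_rot (c s : R) (f : R * R -> \bar R) :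
  (c ^+ 2 + s ^+ 2 = 1)%R -> measurable_fun setT f -> (forall x, 0 <= f x) ->
  \int[mu2]_p f (rot c s p) = \int[mu2]_p f p.
Proof.
move=> cs mf f0; have [s0|s0] := eqVneq s 0%R; last exact: ge0_integral_rot_neq0.
(* For [s = 0] the rotation is the composite of two quarter turns, with cosine and sine [(0, 1)] and
   [(s, - c)]; both have nonzero sine, so the three-shear case applies to each. *)
have c0 : (- c != 0)%R.
  by apply/eqP => c0; move: cs; rewrite s0 -sqrrN c0 expr0n/= addr0; lra.
rewrite -[RHS](@ge0_integral_rot_neq0 0%R 1%R)//; last by rewrite expr0n expr1n add0r.
rewrite -[RHS](@ge0_integral_rot_neq0 s (- c)%R (fun p => f (rot 0 1 p)%R))//.
- apply: eq_integral => -[x y] _; rewrite /rot/=; congr (f (_, _)); ring.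
- by rewrite sqrrN addrC.
- exact: measurableT_comp mf (measurable_rot _ _).
Qed.

End area_invariance.

(** * Complex modulus and Jensen's formula *)

Section modulus_theory.
Context {R : realType}.
Local Open Scope complex_scope.
Implicit Types z w : R[i].

Lemma modulusE z : modulus z = Num.sqrt (Re z ^+ 2 + Im z ^+ 2).
Proof. by case: z. Qed.

Lemma modulus0 : modulus (0 : R[i]) = 0.
Proof. exact: ComplexField.Normc.normc0. Qed.

Lemma modulus1 : modulus (1 : R[i]) = 1.
Proof. exact: ComplexField.Normc.normc1. Qed.

Lemma modulusM z w : modulus (z * w) = modulus z * modulus w.
Proof. exact: ComplexField.Normc.normcM. Qed.

Lemma modulusV z : modulus z^-1 = (modulus z)^-1.
Proof. exact: ComplexField.Normc.normcV. Qed.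

Lemma modulusN z : modulus (- z) = modulus z.
Proof. exact: (@normcN R z). Qed.

Lemma modulus_ge0 z : 0 <= modulus z.
Proof. by rewrite modulusE sqrtr_ge0. Qed.

Lemma modulus_gt0 z : (0 < modulus z) = (z != 0).
Proof.
rewrite lt_neqAle modulus_ge0 andbT eq_sym; congr (~~ _).
by apply/eqP/eqP => [/ComplexField.Normc.eq0_normc//|->]; rewrite modulus0.
Qed.

Lemma ler_modulusD z w : modulus (z + w) <= modulus z + modulus w.
Proof. exact: (@le_normcD R z w). Qed.

Lemma modulus_conj z : modulus z^* = modulus z.
Proof. by case: z => a b; rewrite !modulusE/= sqrrN. Qed.

Lemma modulus_real (r : R) : 0 <= r -> modulus r%:C = r.
Proof. by move=> r0; rewrite modulusE/= expr0n/= addr0 sqrtr_sqr ger0_norm. Qed.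

Lemma modulus_sub_le z : modulus (1 - z) <= 1 + modulus z.
Proof. by rewrite (le_trans (ler_modulusD _ _))// modulus1 modulusN. Qed.

Lemma modulus_sub_ge z : 1 - modulus z <= modulus (1 - z).
Proof.
have := ler_modulusD (1 - z) z.
by rewrite subrK modulus1 -lerBlDr.
Qed.

Lemma normc_modulus z : `|z| = (modulus z)%:C.
Proof. by rewrite normc_def modulusE. Qed.

Lemma expiD (s t : R) : expi (s + t) = expi s * expi t.
Proof. by rewrite /expi sinD cosD; simpc; congr (_ +i* _); rewrite addrC [sin s * _]mulrC. Qed.

Lemma modulus_expi (t : R) : modulus (expi t) = 1.
Proof. by rewrite modulusE/= cos2Dsin2 sqrtr1. Qed.

Lemma expi_pi : expi pi = -1 :> R[i].
Proof. by rewrite /expi cospi sinpi; simpc. Qed.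

Lemma expi_conj (t : R) : expi t * (expi t)^* = 1.
Proof.
rewrite /expi; simpc; apply/eqP; rewrite eq_complex/= -!expr2 cos2Dsin2.
by rewrite eqxx/=; apply/eqP; ring.
Qed.

End modulus_theory.

(** * Measurability of complex-valued functions *)

Section cmeasurable.
Context {R : realType} d (T : measurableType d).
Local Open Scope complex_scope.
Implicit Types f g : T -> R[i].

(** Stated on coordinates, so that no sigma-algebra on [R[i]] has to be chosen. *)
Definition cmeasurable f :=
  measurable_fun setT (fun x => Re (f x)) /\ measurable_fun setT (fun x => Im (f x)).

Lemma cmeasurable_cst (c : R[i]) : cmeasurable (fun=> c).
Proof. by split; exact: measurable_cst. Qed.

Lemma cmeasurableM f g : cmeasurable f -> cmeasurable g ->
  cmeasurable (fun x => f x * g x).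
Proof.
have ReM (z w : R[i]) : Re (z * w) = Re z * Re w - Im z * Im w by case: z w => [? ?] [? ?].
have ImM (z w : R[i]) : Im (z * w) = Re z * Im w + Im z * Re w by case: z w => [? ?] [? ?].
move=> [f1 f2] [g1 g2]; split.
  by under eq_fun do rewrite ReM; apply: measurable_funB; exact: measurable_funM.
by under eq_fun do rewrite ImM; apply: measurable_funD; exact: measurable_funM.
Qed.

Lemma cmeasurableB f g : cmeasurable f -> cmeasurable g ->
  cmeasurable (fun x => f x - g x).
Proof.
have ReB (z w : R[i]) : Re (z - w) = Re z - Re w by case: z w => [? ?] [? ?].
have ImB (z w : R[i]) : Im (z - w) = Im z - Im w by case: z w => [? ?] [? ?].
move=> [f1 f2] [g1 g2]; split.
  by under eq_fun do rewrite ReB; exact: measurable_funB.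
by under eq_fun do rewrite ImB; exact: measurable_funB.
Qed.

Lemma measurable_modulus f : cmeasurable f ->
  measurable_fun setT (fun x => modulus (f x)).
Proof.
move=> [f1 f2]; under eq_fun do rewrite modulusE.
apply: (measurableT_comp (continuous_measurable_fun (@sqrt_continuous R))).
by apply: measurable_funD; exact: measurable_funX.
Qed.

Lemma measurable_ln_modulus f : cmeasurable f ->
  measurable_fun setT (fun x => ln (modulus (f x))).
Proof.
by move=> mf; apply: (measurableT_comp (@measurable_ln R)); exact: measurable_modulus.
Qed.

End cmeasurable.

(** * Jensen's formula for [|z| < 1] *)

Section circle.
Context {R : realType}.
Local Notation mu := (@lebesgue_measure R).
Implicit Types z : R[i].

Lemma cmeasurable_expi : cmeasurable (expi : measurableTypeR R -> R[i]).
Proof.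
by split; apply: continuous_measurable_fun; [exact: continuous_cos|exact: continuous_sin].
Qed.

(** The contribution to [log|P|] on the unit circle of one factor of [P], [z] being the inverse of a
    root. *)
Definition circle_log z (t : R) : R := ln (modulus (1 - z * expi t)).

Lemma measurable_circle_log z :
  measurable_fun [set: measurableTypeR R] (circle_log z).
Proof.
apply: measurable_ln_modulus; apply: cmeasurableB; first exact: cmeasurable_cst.
by apply: cmeasurableM; [exact: cmeasurable_cst|exact: cmeasurable_expi].
Qed.

Lemma integrable_bounded_itv (f : R -> R) (a b B : R) :
  measurable_fun setT f -> (forall x, `|f x| <= B) ->
  mu.-integrable `[a, b] (EFin \o f).
Proof.
move=> mf fB; apply: measurable_bounded_integrable => //.
- by rewrite /= lebesgue_measure_itv/=; case: ifP => // _; rewrite -EFinB ltry.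
- exact: measurable_funTS.
- by exists B; split; [exact: num_real|move=> M BM x _; exact: le_trans (fB x) (ltW BM)].
Qed.

(** The interval is split at [h] and its upper half is translated back onto the lower one;
    boundedness supplies integrability. *)
Lemma Rintegral_halve (f : R -> R) (h B : R) : 0 <= h ->
  measurable_fun setT f -> (forall x, `|f x| <= B) ->
  \int[mu]_(t in `[0, h + h]) f t = \int[mu]_(t in `[0, h]) (f t + f (t + h)).
Proof.
move=> h0 mf fB.
have mfh : measurable_fun setT (fun x : R => f (x + h)).
  exact: measurableT_comp mf (measurable_shift h).
have ifh a b : mu.-integrable `[a, b] (EFin \o (fun x : R => f (x + h))).
  by apply: (@integrable_bounded_itv _ _ _ B).
have if_ a b : mu.-integrable `[a, b] (EFin \o f).
  by apply: (@integrable_bounded_itv _ _ _ B).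
rewrite RintegralD//.
have := @Rintegral_itvB R f (BLeft 0) (BRight (h + h)) h (if_ _ _).
rewrite !bnd_simp h0 lerDl => /(_ isT h0) /eqP; rewrite subr_eq => /eqP ->.
rewrite [LHS]addrC; congr (_ + _); rewrite Rintegral_itv_obnd_cbnd; last first.
  by apply: integrableS (if_ 0 (h + h)) => //; apply: subset_itvScc; rewrite ?bnd_simp.
rewrite /Rintegral; congr fine; have mphi := measurable_shift h.
rewrite (eq_measure_integral (pushforward mu (fun x : R => (x + h)%R : measurableTypeR R))); last first.
  by move=> A mA _ /=; rewrite lebesgue_measure_shift.
have pre : (fun x : R => x + h) @^-1` `[h, h + h] = `[0, h]%classic.
  by apply/seteqP; split => x /=; rewrite !in_itv/= lerDr lerD2r.
rewrite (@integral_pushforward _ _ _ _ R _ (measurable_shift h) mu _ (EFin \o f))//.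
- by rewrite pre.
- by apply: measurableT_comp => //.
- by rewrite pre; exact: ifh.
Qed.

(** For [|z| <= r < 1], [circle_log z] lies between [ln (1 - r) <= 0] and [ln 2 >= 0], so the
    difference of these bounds dominates its absolute value. *)
Definition circle_bound (r : R) : R := ln 2 - ln (1 - r).

Lemma circle_log_bound r z t : r < 1 -> modulus z <= r ->
  `|circle_log z t| <= circle_bound r.
Proof.
move=> r1 zr; rewrite /circle_log.
set w := z * expi t; have wr : modulus w <= r by rewrite modulusM modulus_expi mulr1.
have r0 : 0 <= r := le_trans (modulus_ge0 w) wr.
have lo : 1 - r <= modulus (1 - w).
  by rewrite (le_trans _ (modulus_sub_ge w))// lerD2l lerN2.
have hi : modulus (1 - w) <= 2 by have := modulus_sub_le w; lra.
have p0 : 0 < modulus (1 - w) by lra.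
have l1 : ln (1 - r) <= ln (modulus (1 - w)) by rewrite ler_ln// posrE; lra.
have l2 : ln (modulus (1 - w)) <= ln 2 by rewrite ler_ln// posrE.
have l3 : 0 <= ln 2 :> R by rewrite ln_ge0// ler1n.
have l4 : ln (1 - r) <= 0 by rewrite ln_le0//; lra.
by rewrite /circle_bound ler_norml; lra.
Qed.

(* [(1 - z e^(ikt)) (1 - z e^(ik(t + pi/k))) = 1 - z^2 e^(2ikt)] *)
Lemma Rintegral_circle_log_double z (k : R) : modulus z < 1 -> 0 < k ->
  \int[mu]_(t in `[0, 2 * pi / k]) circle_log z (k * t) =
  \int[mu]_(t in `[0, 2 * pi / (2 * k)]) circle_log (z * z) (2 * k * t).
Proof.
move=> z1 k0.
have -> : 2 * pi / k = pi / k + pi / k by rewrite -mulrDl mulr_natl mulr2n.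
have -> : 2 * pi / (2 * k) = pi / k by rewrite -mulf_div divff ?mul1r// pnatr_eq0.
rewrite (@Rintegral_halve _ _ (circle_bound (modulus z))).
- apply: eq_Rintegral => t _; rewrite /circle_log.
  have wlt w : modulus w = modulus z -> 0 < modulus (1 - w).
    by move=> wz; rewrite (lt_le_trans _ (modulus_sub_ge w))// wz subr_gt0.
  rewrite -lnM ?posrE ?wlt ?modulusM ?modulus_expi ?mulr1//.
  rewrite -modulusM; congr (ln (modulus _)).
  rewrite [in k * (t + _)]mulrDr mulrCA divff ?gt_eqF// mulr1 expiD expi_pi.
  have -> : 2 * k * t = k * t + k * t by ring.
  rewrite expiD.
  by set e := expi _; ring.
- by rewrite divr_ge0 ?pi_ge0// ltW.
- apply: (measurableT_comp (measurable_circle_log z)).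
  by apply: measurable_funM => //; exact: measurable_cst.
- by move=> t; exact: circle_log_bound.
Qed.

(** Each doubling of the frequency [k] halves the interval and replaces [z] by [z^2], which stays in
    the disk of radius [r], so the bound on the integrand does not change. After [n] doublings the
    trivial estimate has gained [2^n]. *)
Lemma Rintegral_circle_log_le r z (k : R) n : r < 1 -> modulus z <= r -> 0 < k ->
  `|\int[mu]_(t in `[0, 2 * pi / k]) circle_log z (k * t)|
    <= circle_bound r * (2 * pi / k) / 2 ^+ n.
Proof.
move=> r1; elim: n z k => [|n IH] z k zr k0.
  have i1 : mu.-integrable `[0, 2 * pi / k] (EFin \o (fun t => circle_log z (k * t))).
    apply: (@integrable_bounded_itv _ _ _ (circle_bound r)).
      apply: (measurableT_comp (measurable_circle_log z)).
      by apply: measurable_funM => //; exact: measurable_cst.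
    by move=> t; exact: circle_log_bound.
  rewrite expr0 divr1.
  apply: le_trans (le_normr_Rintegral _ i1) _ => //.
  have pk : 0 <= 2 * pi / k by rewrite divr_ge0 ?mulr_ge0 ?pi_ge0// ltW.
  apply: (@le_trans _ _ (\int[mu]_(t in `[0, 2 * pi / k]) circle_bound r)).
    apply: le_Rintegral => //.
    - exact: integrable_norm.
    - exact: (@integrable_bounded_itv _ _ _ `|circle_bound r|).
    - by move=> t _; exact: circle_log_bound.
  rewrite Rintegral_cst//= lebesgue_measure_itv/= lte_fin lt_neqAle pk andbT.
  by case: eqP => /= [<-|_]; rewrite ?mulr0// subr0.
rewrite Rintegral_circle_log_double//; last exact: le_lt_trans zr r1.
have zzr : modulus (z * z) <= r.
  rewrite modulusM (le_trans _ zr)// ler_piMl ?modulus_ge0//.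
  by rewrite (le_trans zr)// ltW.
have k20 : 0 < 2 * k by rewrite mulr_gt0.
apply: le_trans (IH _ _ zzr k20) _.
rewrite exprS invfM !mulrA invfM !mulrA.
by rewrite le_eqVlt; apply/orP; left; apply/eqP; ring.
Qed.

Lemma Rintegral_circle_log_lt1 z : modulus z < 1 ->
  \int[mu]_(t in `[0, 2 * pi]) circle_log z t = 0.
Proof.
move=> z1.
have H n := Rintegral_circle_log_le n z1 (lexx _) ltr01.
apply/eqP; rewrite -normr_le0; apply/ler_addgt0Pl => e e0; rewrite addr0.
under eq_Rintegral do rewrite -[t in circle_log z t]mul1r.
rewrite -[X in `[0, X]]divr1.
set b := circle_bound _ * _ in H.
have b0 : 0 <= b.
  have := H 0%N; rewrite expr0 [X in _ <= X]divr1; apply: le_trans.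
  exact: normr_ge0.
(* This [n] exceeds [b / e], and [n <= 2^n], so [b / 2^n <= e]. *)
pose n := Num.bound (b / e).
apply: le_trans (H n) _.
rewrite ler_pdivrMr ?exprn_gt0// mulrC -ler_pdivrMr//.
have h1 : b / e < n%:R by rewrite archi_boundP// divr_ge0// ltW.
rewrite (le_trans (ltW h1))// -natrX ler_nat ltnW// ltn_expl//.
Qed.

End circle.

(** * Integrability of functions bounded above *)

Section integral_from_complement.
Context {R : realType} d (T : measurableType d) (mu : {measure set T -> \bar R}).

Lemma integrable_EFinB (D : set T) (f g : T -> R) : measurable D ->
  mu.-integrable D (EFin \o f) -> mu.-integrable D (EFin \o g) ->
  mu.-integrable D (EFin \o (fun x => f x - g x)).
Proof. by move=> mD fi gi; exact: (integrableB mD fi gi). Qed.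

(** Logarithms unbounded below are handled through [C - f >= 0], to which monotone convergence and
    Tonelli apply; as [V] is real, [C - f] is integrable, hence so is [f = C - (C - f)]. *)
Lemma integrable_of_bounded_above (D : set T) (f : T -> R) (C V : R) :
  measurable D -> (mu D < +oo)%E -> measurable_fun D f ->
  (forall x, D x -> f x <= C) ->
  (\int[mu]_(x in D) (C - f x)%:E = V%:E)%E ->
  mu.-integrable D (EFin \o f) /\
  \int[mu]_(x in D) f x = C * fine (mu D) - V.
Proof.
move=> mD Dy mf fC IV.
have iC : mu.-integrable D (EFin \o (fun=> C)).
  apply: measurable_bounded_integrable => //.
  by exists `|C|; split; [exact: num_real|move=> M CM x _; exact: ltW].
have iCf : mu.-integrable D (EFin \o (fun x => C - f x)).
  apply/integrableP; split.
    by apply/measurable_EFinP; apply: measurable_funB => //; exact: measurable_cst.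
  under eq_integral.
    move=> x /[!inE] Dx; rewrite /= ger0_norm ?subr_ge0 ?fC//; over.
  by rewrite IV ltry.
have fE : EFin \o f = EFin \o (fun x => C - (C - f x)).
  by apply/funext => x /=; congr EFin; lra.
split.
  by rewrite fE; exact: integrable_EFinB.
rewrite (@eq_Rintegral _ _ _ mu D (fun x => C - (C - f x))); last first.
  by move=> x _; lra.
rewrite RintegralB// Rintegral_cst//; congr (_ - _).
by rewrite /Rintegral IV.
Qed.

End integral_from_complement.

(** * Jensen's formula for every [z] *)

Section jensen.
Context {R : realType}.
Local Notation mu := (@lebesgue_measure R).
Implicit Types z w : R[i].

(** For [Re w] in [[-1, 1]], the angles in [[0, 2 * pi]] with cosine [Re w]. They form a null set
    containing the part of the fiber of [expi] over [w] in that interval. *)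
Definition expi_fiber w : set R := [set acos (Re w); 2 * pi - acos (Re w)].

Lemma expi_fiberP w t : 0 <= t <= 2 * pi -> expi t = w -> expi_fiber w t.
Proof.
move=> /andP[t0 t2] <-; rewrite /expi_fiber/=.
have [tpi|/ltW tpi] := leP t pi; first by left; rewrite cosK// in_itv/= t0.
(* For [t > pi], [cos t = cos (2 pi - t)] with [2 pi - t] in [[0, pi]], where [acos] inverts
   [cos]. *)
right; rewrite -[cos t]cosN -cosD2pi cosK; last by rewrite in_itv/=; lra.
by rewrite -mulr_natl; lra.
Qed.

Lemma measurable_expi_fiber w : measurable (expi_fiber w).
Proof. by apply: measurableU; exact: measurable_set1. Qed.

Lemma expi_fiber_null w : mu (expi_fiber w) = 0%E.
Proof.
apply: countable_lebesgue_measure0; apply: finite_set_countable.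
by rewrite /expi_fiber finite_setU; split; exact: finite_set1.
Qed.

Lemma circle_measure : mu `[0, 2 * pi] = (2 * pi)%:E.
Proof.
rewrite lebesgue_measure_itv/= lte_fin ifT ?sube0//.
by rewrite mulr_gt0// pi_gt0.
Qed.

Lemma circle_log_lt1_integrable z : modulus z < 1 ->
  mu.-integrable `[0, 2 * pi] (EFin \o circle_log z).
Proof.
move=> z1; apply: (@integrable_bounded_itv _ _ _ _ (circle_bound (modulus z))).
  exact: measurable_circle_log.
by move=> t; exact: circle_log_bound.
Qed.

(** Radii increasing to 1. They start at [1/2], whence [- ln (radius n) <= ln 2]. *)
Let radius (n : nat) : R := n.+1%:R / n.+2%:R.

Let radius_gt0 n : 0 < radius n. Proof. by rewrite divr_gt0. Qed.

Let radius_lt1 n : radius n < 1.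
Proof. by rewrite ltr_pdivrMr// mul1r ltr_nat. Qed.

Let radius_ge n : 2^-1 <= radius n.
Proof.
by rewrite /radius -[n.+2]addn1 -[n.+1]addn1 !natrD ler_pdivlMr; have := ler0n R n; lra.
Qed.

Let radius_nd m n : (m <= n)%N -> radius m <= radius n.
Proof.
move=> mn; rewrite ler_pdivrMr// mulrAC ler_pdivlMr// -!natrM ler_nat.
by rewrite !(mulnS _ _.+1) [(n.+1 * _)%N]mulnC leq_add2r.
Qed.

Let cvg_radius : radius @ \oo --> (1 : R).
Proof.
have -> : radius = (fun n => 1 - n.+2%:R^-1).
  apply/funext => n; rewrite /radius -[n.+2%:R in RHS]natr1.
  have := ltr0Sn R n.+1; rewrite -natr1 => h.
  apply: (mulIf (lt0r_neq0 h)); rewrite divfK ?lt0r_neq0//.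
  by rewrite mulrBl mulVf ?lt0r_neq0// mul1r addrK.
rewrite -[X in _ --> X]subr0; apply: cvgB; first exact: cvg_cst.
have := @cvg_harmonic R; rewrite -cvg_shiftS; exact.
Qed.

(* [|1 - s w|^2 / s = s + 1/s - 2 Re w] decreases to [|1 - w|^2] as [s]
   increases to [1], when [|w| = 1]. *)
Let quot w (s : R) : R := s + s^-1 - 2 * Re w.

Let modulus_sqr w : modulus w ^+ 2 = Re w ^+ 2 + Im w ^+ 2.
Proof. by rewrite modulusE sqr_sqrtr// addr_ge0 ?sqr_ge0. Qed.

Let modulus_quot w (s : R) : modulus w = 1 -> 0 < s ->
  modulus (1 - s%:C%C * w) ^+ 2 = s * quot w s.
Proof.
move=> w1 s0; have := modulus_sqr w; rewrite w1 modulus_sqr.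
case: w {w1} => a b /=; rewrite /quot/= mulrBr mulrDr divff ?gt_eqF// => ab.
rewrite !mul0r subr0 addr0 sub0r sqrrN exprMn.
have -> : b ^+ 2 = 1 - a ^+ 2 by move: ab; rewrite expr1n; lra.
ring.
Qed.

(** Half the logarithm of [|1 - s w|^2 = s * quot w s]. The last hypothesis keeps [1 - s w] nonzero,
    since it vanishes only for [s = 1] and [w = 1]. *)
Let circle_log_quot w (s : R) : modulus w = 1 -> 0 < s -> w != 1 \/ s < 1 ->
  0 < quot w s /\
  ln (modulus (1 - s%:C%C * w)) - 2^-1 * ln s = 2^-1 * ln (quot w s).
Proof.
move=> w1 s0 ws.
have q0 : 0 < quot w s.
  rewrite -(pmulr_rgt0 _ s0) -modulus_quot// exprn_gt0// modulus_gt0 subr_eq0.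
  case: ws => [wn1|s1].
    apply/eqP => e.
    have e1 : s = 1.
      by move: (congr1 modulus e); rewrite modulusM modulus1 w1 mulr1 modulus_real// ltW.
    by move: e; rewrite e1 mul1r => /esym/eqP; rewrite (negbTE wn1).
  apply/eqP => e; move: (congr1 modulus e).
  by rewrite modulusM modulus1 w1 mulr1 modulus_real ?ltW// => e1; move: s1; rewrite -e1 ltxx.
split=> //.
have m0 : 0 < modulus (1 - s%:C%C * w).
  rewrite lt_neqAle modulus_ge0 andbT eq_sym -sqrf_eq0.
  by rewrite modulus_quot// mulf_neq0// lt0r_neq0.
have : ln (modulus (1 - s%:C%C * w) ^+ 2) = ln s + ln (quot w s).
  by rewrite modulus_quot// lnM.
by rewrite lnXn//; lra.
Qed.

(** Monotone convergence along the radii [radius n], off the null set where [1 - z e^(it)] vanishes;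
    the approximating integrals are known from the case of modulus less than 1. *)
Lemma circle_log_unit_integral z : modulus z = 1 ->
  (\int[mu]_(t in `[0%R, (2 * pi)%R]) (2 * ln 2 - circle_log z t)%:E =
   (2 * ln 2 * (2 * pi))%:E)%E.
Proof.
move=> z1.
have z0 : z != 0 by rewrite -modulus_gt0 z1.
pose N := expi_fiber z^-1; pose D := `[0, 2 * pi]%classic : set R.
have mN : measurable N := measurable_expi_fiber _.
have mD : measurable D by exact: measurable_itv.
have N0 : mu N = 0%E := expi_fiber_null _.
(* Subtracting [ln (radius n) / 2] leaves half the logarithm of [quot], which is monotone in the
   radius. Of the two [ln 2], one dominates [circle_log] and the other [- ln (radius n) / 2], so
   [g n] is nonnegative. *)
pose g n t := 2 * ln 2 - (circle_log ((radius n)%:C%C * z) t - 2^-1 * ln (radius n)).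
have mg n : measurable_fun setT (g n).
  apply: measurable_funB; first exact: measurable_cst.
  by apply: measurable_funB; [exact: measurable_circle_log|exact: measurable_cst].
have ln2 : 0 <= ln 2 :> R by rewrite ln_ge0// ler1n.
have circle_le w t : modulus w <= 1 -> circle_log w t <= ln 2.
  move=> w1; rewrite /circle_log.
  have [e|n] := eqVneq (1 - w * expi t) 0; first by rewrite e modulus0 ln0.
  rewrite ler_ln ?posrE ?modulus_gt0//.
  rewrite (le_trans (modulus_sub_le _))// modulusM modulus_expi mulr1.
  by lra.
have g0 n t : 0 <= g n t.
  rewrite /g.
  have : circle_log ((radius n)%:C%C * z) t <= ln 2.
    by apply: circle_le; rewrite modulusM z1 mulr1 modulus_real ltW.
  have : - ln (radius n) <= ln 2.
    by rewrite -lnV ?posrE// ler_ln ?posrE ?invr_gt0// -[leRHS]invrK lef_pV2 ?posrE.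
  lra.
have zt t : (D `\` N) t -> z * expi t != 1.
  move=> [Dt Nt]; apply/eqP => e; apply: Nt; apply: expi_fiberP => //.
  by apply: (mulfI z0); rewrite e divff.
have gE n t : g n t = 2 * ln 2 - 2^-1 * ln (quot (z * expi t) (radius n)).
  rewrite /g /circle_log -mulrA; congr (_ - _).
  have [] // := @circle_log_quot (z * expi t) (radius n).
    by rewrite modulusM z1 modulus_expi mulr1.
  by right.
have ndg t : (D `\` N) t -> {homo (fun n => g n t) : m n / (m <= n)%N >-> m <= n}.
  move=> Dt m n mn; rewrite !gE lerD2l lerN2 ler_pM2l ?invr_gt0//.
  have q0 k : 0 < quot (z * expi t) (radius k).
    have [] // := @circle_log_quot (z * expi t) (radius k).
      by rewrite modulusM z1 modulus_expi mulr1.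
    by right.
  rewrite ler_ln ?posrE// /quot lerD2r.
  have := radius_nd mn; have := radius_gt0 m; have := radius_lt1 n; have := radius_gt0 n.
  set a := radius n; set b := radius m => a0 a1 b0 ba.
  rewrite -subr_ge0.
  have -> : b + b^-1 - (a + a^-1) = (a - b) * (1 - a * b) / (a * b).
    by field; rewrite !gt_eqF.
  apply: divr_ge0; last by rewrite mulr_ge0 ?ltW.
  rewrite mulr_ge0 ?subr_ge0//.
  by rewrite mulr_ile1 ?ltW// (le_lt_trans ba).
have cvgg t : (D `\` N) t -> (g n t)%:E @[n --> \oo] --> (2 * ln 2 - circle_log z t)%:E.
  move=> Dt; apply: cvg_EFin; first by near=> n.
  rewrite (_ : _ \o _ = fun n => g n t)//.
  under eq_fun do rewrite gE.
  have [|||q1 e1] := @circle_log_quot (z * expi t) 1.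
  - by rewrite modulusM z1 modulus_expi mulr1.
  - by [].
  - by left; exact: zt.
  have -> : circle_log z t = 2^-1 * ln (quot (z * expi t) 1).
    by rewrite -e1 ln1 mulr0 subr0 mul1r.
  apply: cvgB; first exact: cvg_cst.
  apply: cvgMr; apply: (continuous_cvg _ (continuous_ln q1)).
  rewrite /quot; apply: cvgB; last exact: cvg_cst.
  by apply: cvgD => //; apply: cvgV => //; rewrite oner_eq0.
have gint n : (\int[mu]_(t in D `\` N) (g n t)%:E =
    (2 * ln 2 * (2 * pi) + 2^-1 * ln (radius n) * (2 * pi))%:E)%E.
  have zn1 : modulus ((radius n)%:C%C * z) < 1.
    by rewrite modulusM z1 mulr1 modulus_real ?ltW.
  have icl := circle_log_lt1_integrable zn1.
  have icst (c : R) : mu.-integrable D (EFin \o (fun=> c)).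
    by apply: (@integrable_bounded_itv _ _ _ _ `|c|).
  have ig : mu.-integrable D (EFin \o g n).
    by apply: integrable_EFinB => //; apply: integrable_EFinB => //; exact: icst.
  rewrite -(@negligible_integral _ _ _ mu D N)// -[LHS]fineK; last first.
    exact: integrable_fin_num.
  congr EFin.
  transitivity (\int[mu]_(t in D) (2 * ln 2 + 2^-1 * ln (radius n)
      - circle_log ((radius n)%:C%C * z) t)).
    by apply: eq_Rintegral => t _; rewrite /g; lra.
  rewrite RintegralB// Rintegral_circle_log_lt1// Rintegral_cst//.
  by rewrite -/D [X in fine X]circle_measure/= subr0 mulrDl.
have mcl : measurable_fun D (fun t => (2 * ln 2 - circle_log z t)%:E).
  apply/measurable_EFinP; apply: measurable_funTS; apply: measurable_funB.
    exact: measurable_cst.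
  exact: measurable_circle_log.
rewrite -/D (@ge0_negligible_integral _ _ _ mu D N)//; last first.
  move=> t _; rewrite lee_fin.
  have := circle_le z t; rewrite z1 => /(_ (lexx _)); lra.
have h1 n : measurable_fun (D `\` N) (fun t => (g n t)%:E).
  by apply/measurable_EFinP; exact: measurable_funTS.
have h2 n x : (D `\` N) x -> (0 <= (g n x)%:E)%E by rewrite lee_fin.
have h3 x : (D `\` N) x -> nondecreasing_seq (fun n => (g n x)%:E).
  by move=> Dx m n mn; rewrite lee_fin; exact: ndg.
have cv := @cvg_monotone_convergence _ _ _ mu _ (measurableD mD mN) _ h1 h2 h3.
have <- : (\int[mu]_(t in D `\` N) limn (fun n => (g n t)%:E) =
    \int[mu]_(t in D `\` N) (2 * ln 2 - circle_log z t)%:E)%E.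
  by apply: eq_integral => t /[!inE] Dt; apply/cvg_lim => //; exact: cvgg.
(* The explicit integrals of [g n] give the limit a second time, since [ln (radius n)] tends to
   [ln 1 = 0]. *)
apply: (cvg_unique _ cv) => //; rewrite (funext gint).
apply: cvg_EFin; first by near=> n.
rewrite -[X in _ --> X]addr0; apply: cvgD; first exact: cvg_cst.
rewrite -[X in _ --> X](mul0r (2 * pi)); apply: cvgMl.
rewrite -[X in _ --> X](mulr0 2^-1); apply: cvgMr.
rewrite -[X in _ --> X]ln1; apply: (continuous_cvg _ _ cvg_radius).
exact: continuous_ln.
Unshelve. all: by end_near. Qed.

(** Integrability is stated too, as the integrand is unbounded for [|z| = 1]. At [z = 0] the
    convention [ln 0 = 0] gives the right value 0. *)
Lemma jensen z : mu.-integrable `[0, 2 * pi] (EFin \o circle_log z) /\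
  \int[mu]_(t in `[0, 2 * pi]) circle_log z t = 2 * pi * Num.max 0 (ln (modulus z)).
Proof.
have [z1|z1|z1] := ltgtP (modulus z) 1.
- split; first exact: circle_log_lt1_integrable.
  rewrite Rintegral_circle_log_lt1//.
  by rewrite max_l ?mulr0// ln_le0// ltW.
- have z0 : z != 0 by rewrite -modulus_gt0 (lt_trans _ z1).
  (* The reflection of [z] in the unit circle: [|1 - z e^(it)| = |z| |1 - w e^(it)|], by conjugating
     the last factor and using [|e^(it)| = 1]. *)
  pose w := (z^-1)^*%C.
  have w1 : modulus w < 1 by rewrite /w modulus_conj modulusV invf_lt1// (lt_trans _ z1).
  have e t : circle_log z t = ln (modulus z) + circle_log w t.
    have p1 : 0 < modulus (1 - w * expi t).
      rewrite (lt_le_trans _ (modulus_sub_ge _))// modulusM modulus_expi mulr1.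
      by rewrite subr_gt0.
    rewrite /circle_log -lnM ?posrE ?modulus_gt0//; last by rewrite -modulus_gt0.
    congr ln.
    rewrite -[modulus (1 - w * _)]modulus_conj -modulusM.
    have -> : ((1 - w * expi t)^*)%C = 1 - z^-1 * ((expi t)^*)%C.
      by rewrite rmorphB rmorph1 rmorphM; congr (1 - _ * _); exact: conjcK.
    rewrite mulrBr mulr1 mulrA divff// mul1r.
    rewrite -[in RHS](mulr1 (modulus _)) -(modulus_expi t) -modulusM.
    rewrite mulrBl [(_)^*%C * _]mulrC expi_conj.
    by rewrite -modulusN opprB.
  have iw := circle_log_lt1_integrable w1.
  have ic : mu.-integrable `[0, 2 * pi] (EFin \o (fun=> ln (modulus z))).
    by apply: (@integrable_bounded_itv _ _ _ _ `|ln (modulus z)|).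
  have -> : circle_log z = (fun t => ln (modulus z) + circle_log w t).
    by apply/funext => t; exact: e.
  split; first exact: (integrableD _ ic iw).
  rewrite RintegralD// Rintegral_circle_log_lt1// Rintegral_cst//.
  rewrite [X in fine X]circle_measure/= addr0 max_r 1?mulrC//.
  by rewrite ln_ge0// ltW.
- have := @integrable_of_bounded_above R _ _ mu `[0, 2 * pi] (circle_log z) (2 * ln 2)
    (2 * ln 2 * (2 * pi)).
  case.
  + exact: measurable_itv.
  + by rewrite [X in (X < _)%E]circle_measure ltry.
  + by apply: measurable_funTS; exact: measurable_circle_log.
  + move=> t _; rewrite /circle_log.
    have [e|n] := eqVneq (1 - z * expi t) 0.
      by rewrite e modulus0 ln0// mulr_ge0// ln_ge0// ler1n.
    have : ln (modulus (1 - z * expi t)) <= ln 2.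
      rewrite ler_ln ?posrE ?modulus_gt0//.
      by rewrite (le_trans (modulus_sub_le _))// modulusM modulus_expi mulr1 z1.
    have : 0 <= ln 2 :> R by rewrite ln_ge0// ler1n.
    lra.
  + exact: circle_log_unit_integral.
  move=> iz ->; split => //.
  by rewrite [X in fine X]circle_measure/= subrr z1 ln1 maxxx mulr0.
Qed.

End jensen.

(** * Integrals over the unit disk *)

Section disk_area.
Context {R : realType}.
Local Notation mu := (@lebesgue_measure R).
Local Notation mu2 := (mu \x mu)%E.
Local Open Scope complex_scope.

Lemma integral_FTC (f F : R -> R) (a b : R) : a < b -> continuous f ->
  (forall x : R, is_derive x 1 F (f x)) ->
  (\int[mu]_(x in `[a, b]) (f x)%:E = (F b - F a)%:E)%E.
Proof.
move=> ab cf dF; have dF1 x : derivable F x 1 by exact: ex_derive.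
have cF : continuous F.
  by move=> x; exact/differentiable_continuous/derivable1_diffP.
rewrite (@continuous_FTC2 _ f F)//.
- by apply: continuous_subspaceT.
- split=> //; [exact/cvg_at_right_filter/cF|exact/cvg_at_left_filter/cF].
- by move=> x _; rewrite derive1E derive_val.
Qed.

Definition disk (r : R) : set (measurableTypeR R * measurableTypeR R) :=
  [set p | modulus (p.1 +i* p.2) < r].

Lemma cmeasurable_plane :
  cmeasurable (fun p : measurableTypeR R * measurableTypeR R => p.1 +i* p.2).
Proof. by split => /=; [exact: measurable_fst|exact: measurable_snd]. Qed.

Lemma measurable_disk r : measurable (disk r).
Proof.
rewrite (_ : disk r = setT `&`
    (fun p : measurableTypeR R * measurableTypeR R => modulus (p.1 +i* p.2)) @^-1` `]-oo, r[).
  by apply: measurable_modulus => //; exact: cmeasurable_plane.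
by rewrite setTI; apply/seteqP; split => p /=; rewrite in_itv.
Qed.

Lemma disk_xsection (r x : R) : 0 <= r ->
  xsection (disk r) x =
  `](- Num.sqrt (r ^+ 2 - x ^+ 2)), (Num.sqrt (r ^+ 2 - x ^+ 2))[%classic.
Proof.
move=> r0.
have dE y : ((x, y) \in disk r) = (Num.sqrt (x ^+ 2 + y ^+ 2) < r).
  by apply/idP/idP; rewrite inE.
apply/seteqP; split => y; rewrite /xsection/= dE in_itv/=;
  move: (y : R) => {}y; have y2 := sqr_ge0 y; have x2 := sqr_ge0 x.
- rewrite -[r in X in X -> _](ger0_norm r0) -sqrtr_sqr => h.
  have h1 : x ^+ 2 + y ^+ 2 < r ^+ 2.
    by rewrite ltNge; apply/negP => /(@ler_wsqrtr R); rewrite leNgt h.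
  rewrite -ltr_norml -sqrtr_sqr ltr_sqrt; lra.
- rewrite -ltr_norml -sqrtr_sqr => h.
  have h1 : y ^+ 2 < r ^+ 2 - x ^+ 2.
    by rewrite ltNge; apply/negP => /(@ler_wsqrtr R); rewrite leNgt h.
  rewrite -[ltRHS](ger0_norm r0) -sqrtr_sqr ltr_sqrt; last first.
    by rewrite (le_lt_trans _ (_ : y ^+ 2 + x ^+ 2 < _)) ?addr_ge0 ?sqr_ge0//; lra.
  lra.
Qed.

(** Slicing gives the integral of [2 sqrt (r^2 - x^2)] over [[-r, r]], computed by the substitution
    [x = r sin t]. *)
Lemma area_disk (r : R) : 0 < r -> (mu2 (disk r) = (pi * r ^+ 2)%:E)%E.
Proof.
move=> r0; have rge0 := ltW r0.
rewrite /product_measure1.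
pose h (x : R) : R := 2 * Num.sqrt (r ^+ 2 - x ^+ 2).
have -> : (\int[mu]_x (mu \o xsection (disk r)) x = \int[mu]_(x in `[(- r)%R, r]) (h x)%:E)%E.
  rewrite [RHS]integral_mkcond; apply: eq_integral => x _ /=.
  rewrite disk_xsection// lebesgue_measure_itv/= lte_fin patchE mem_setE in_itv/=.
  rewrite -ler_norml.
  have [xr|xr] := leP `|x| r.
    rewrite /h; set s := Num.sqrt _.
    have s0 : 0 <= s by exact: sqrtr_ge0.
    by case: ifPn => [_|]; [rewrite -EFinD; congr EFin; lra|rewrite -leNgt => ?; congr EFin; lra].
  (* For [|x| > r] the square root of a negative number is 0 by convention, so the section is an
     empty interval. *)
  rewrite ler0_sqrtr ?oppr0 ?ltxx//.
  by rewrite subr_le0 -(real_normK (num_real x)) ler_pXn2r ?nnegrE// ltW.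
pose F (t : R) : R := r * sin t.
have dF (t : R) : is_derive t 1 F (r * cos t) by exact: is_deriveZ.
have F'E : derive1 F = (fun t => r * cos t).
  by apply/funext => t; rewrite derive1E derive_val.
have ccos : continuous (fun t : R => r * cos t).
  by move=> t; apply: cvgMr; exact: continuous_cos.
have cF : continuous F.
  by move=> t; apply: cvgMr; exact: continuous_sin.
have Fb : F (pi / 2) = r by rewrite /F sin_pihalf mulr1.
have Fa : F (- (pi / 2)) = - r by rewrite /F sinN sin_pihalf mulrN1.
have ch : continuous h.
  move=> x; apply: cvgMr; apply: (continuous_cvg _ (@sqrt_continuous R _)).
  by apply: cvgB; [exact: cvg_cst|exact: exprn_continuous].
have pi0 := pi_gt0 R.
have ab : - (pi / 2) < pi / 2 :> R by lra.
rewrite -[X in `[X, _]]Fa -[X in `[_, X]]Fb.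
rewrite (@integration_by_substitution_increasing _ F h); first last.
- exact: continuous_subspaceT.
- split; first by move=> t _; exact: ex_derive.
  + exact/cvg_at_right_filter/cF.
  + exact/cvg_at_left_filter/cF.
- by rewrite F'E; apply/cvg_ex; exists (r * cos (pi / 2)); exact/cvg_at_left_filter/ccos.
- by rewrite F'E; apply/cvg_ex; exists (r * cos (- (pi / 2))); exact/cvg_at_right_filter/ccos.
- by move=> t _; rewrite F'E; exact: ccos.
- by move=> s t sab tab st; rewrite /F ltr_pM2l// ltr_sin.
- exact: ltW.
(* This is [2 r^2 cos^2 t], in the form the product rule gives for the derivative of [K]. *)
pose k (t : R) : R := r ^+ 2 * (1 + (cos t * cos t - sin t * sin t)).
pose K (t : R) : R := r ^+ 2 * (t + sin t * cos t).
transitivity (\int[mu]_(t in `[(- (pi / 2))%R, (pi / 2)%R]) (k t)%:E)%E.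
  apply: eq_integral => t; rewrite inE/= in_itv/= => tab; congr EFin.
  rewrite F'E /h /F /= fctE /=.
  have -> : r ^+ 2 - (r * sin t) ^+ 2 = (r * cos t) ^+ 2.
    by rewrite !exprMn cos2sin2; ring.
  rewrite sqrtr_sqr ger0_norm ?mulr_ge0 ?cos_ge0_pihalf// /k.
  have -> : sin t * sin t = 1 - cos t * cos t by rewrite -!expr2 sin2cos2.
  ring.
have ck : continuous k.
  move=> t; apply: cvgMr; apply: cvgD; first exact: cvg_cst.
  by apply: cvgB; apply: cvgM; (exact: continuous_cos || exact: continuous_sin).
have dK (t : R) : is_derive t 1 K (k t).
  apply: is_deriveZ; apply: is_deriveD.
  rewrite (_ : _ - _ = sin t *: - sin t + cos t *: cos t).
    exact: is_deriveM.
  by rewrite /GRing.scale/=; ring.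
rewrite (integral_FTC ab ck dK); congr EFin.
by rewrite /K cosN cos_pihalf !mulr0 !addr0; lra.
Qed.

End disk_area.

(** * Circular averages and the area bound for one factor *)

Section disk_average.
Context {R : realType}.
Local Notation mu := (@lebesgue_measure R).
Local Notation mu2 := (mu \x mu)%E.
Local Notation plane := (measurableTypeR R * measurableTypeR R)%type.
Local Open Scope complex_scope.
Implicit Types (w : R[i]) (p : plane).

Lemma area_sigma_finite : sigma_finite [set: plane] mu2.
Proof.
exists (fun n => disk n.+1%:R).
  apply/esym; rewrite -subTset => p _.
  exists (Num.bound (modulus (p.1 +i* p.2))) => //.
  rewrite /disk/=.
  rewrite (lt_trans (archi_boundP (modulus_ge0 _)))// ltr_nat.
  exact: ltnSn.
by move=> n; split; [exact: measurable_disk|rewrite area_disk// ltry].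
Qed.

(* The product of two Lebesgue measures has no canonical sigma-finite
   structure, which Tonelli's theorem requires. *)
Definition area : set plane -> \bar R := mu2.
HB.instance Definition _ := Measure.on area.
HB.instance Definition _ := Measure_isSigmaFinite.Build _ _ _ area area_sigma_finite.

Lemma eq_indic (T U : Type) (A : set T) (B : set U) x y :
  A x = B y -> \1_A x = \1_B y :> R.
Proof.
move=> AB; rewrite !indicE; congr (nat_of_bool _)%:R.
by apply/idP/idP; rewrite !inE AB.
Qed.

Lemma integral_indicM d (T : measurableType d) (m : {measure set T -> \bar R})
    (D : set T) (f : T -> R) :
  (\int[m]_(x in D) (f x)%:E = \int[m]_x (\1_D x * f x)%:E)%E.
Proof.
rewrite integral_mkcond; apply: eq_integral => x _.
by rewrite patchE indicE; case: ifPn => _; rewrite ?mul1r ?mul0r.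
Qed.

Definition plane_modulus p : R := modulus (p.1 +i* p.2).

Lemma measurable_plane_modulus : measurable_fun [set: plane] plane_modulus.
Proof. by apply: measurable_modulus; exact: cmeasurable_plane. Qed.

Lemma plane_modulus_ge0 p : 0 <= plane_modulus p.
Proof. exact: modulus_ge0. Qed.

Definition disk_log w p : R := ln (modulus (1 - w * (p.1 +i* p.2))).

(** The function [log^+]; since [ln 0 = 0], it also vanishes at 0. *)
Definition lnp (x : R) : R := Num.max 0 (ln x).

Lemma lnp_ge0 (x : R) : 0 <= lnp x.
Proof. by rewrite /lnp le_max lexx. Qed.

Lemma measurable_lnp : measurable_fun setT lnp.
Proof. by apply: measurable_maxr; [exact: measurable_cst|exact: measurable_ln]. Qed.

Lemma measurable_disk_log w : measurable_fun [set: plane] (disk_log w).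
Proof.
apply: measurable_ln_modulus; apply: cmeasurableB; first exact: cmeasurable_cst.
by apply: cmeasurableM; [exact: cmeasurable_cst|exact: cmeasurable_plane].
Qed.

Lemma rot_expi (t : R) p :
  (rot (cos t) (sin t) p).1 +i* (rot (cos t) (sin t) p).2 = (p.1 +i* p.2) * expi t.
Proof.
rewrite /rot /expi/=; simpc.
by rewrite !(mulrC (p.1 : R)) !(mulrC (p.2 : R)).
Qed.

(** An upper bound of [disk_log w] on the unit disk; subtracting from it makes the integrands
    nonnegative, as Tonelli's theorem requires. *)
Let bound w : R := ln (1 + modulus w).

Let disk_log_le w p : disk 1 p -> disk_log w p <= bound w.
Proof.
rewrite /disk_log /bound => Dp.
have w0 := modulus_ge0 w.
have [->|n] := eqVneq (1 - w * (p.1 +i* p.2)) 0.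
  by rewrite modulus0 ln0// ln_ge0//; lra.
rewrite ler_ln ?posrE ?modulus_gt0//; last by lra.
rewrite (le_trans (modulus_sub_le _))// lerD2l modulusM ler_piMr//.
exact: ltW.
Qed.

Let lnp_le w p : disk 1 p -> lnp (modulus w * plane_modulus p) <= lnp (modulus w).
Proof.
move=> Dp; rewrite /lnp ge_max le_max lexx/=.
have [->|m0] := eqVneq (modulus w * plane_modulus p) 0; first by rewrite ln0// le_max lexx.
have m1 : 0 < modulus w * plane_modulus p.
  by rewrite lt_neqAle eq_sym m0 mulr_ge0 ?modulus_ge0.
have w0 : 0 < modulus w.
  rewrite lt_neqAle modulus_ge0 andbT eq_sym; apply: contra_neq m0 => ->.
  by rewrite mul0r.
rewrite le_max ler_ln ?posrE// ler_piMr ?orbT// ltW//.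
Qed.

Let measurable_lnp_plane w :
  measurable_fun [set: plane] (fun p => lnp (modulus w * plane_modulus p)).
Proof.
apply: (measurableT_comp measurable_lnp); apply: measurable_funM => //.
exact: measurable_plane_modulus.
Qed.

(* By rotation invariance of the area, the integrand may be replaced by its
   average over circles, which Jensen's formula computes. *)
Lemma disk_log_average w :
  (\int[mu2]_(p in disk 1) (bound w - disk_log w p)%:E =
   \int[mu2]_(p in disk 1) (bound w - lnp (modulus w * plane_modulus p))%:E)%E.
Proof.
rewrite [LHS]integral_indicM [RHS]integral_indicM.
pose h p : R := \1_(disk 1) p * (bound w - disk_log w p).
have h0 p : 0 <= h p.
  rewrite /h indicE; case: (boolP (p \in disk 1)) => [|_]; last by rewrite mul0r.
  by rewrite inE => Dp; rewrite mul1r subr_ge0 disk_log_le.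
have mh : measurable_fun [set: plane] h.
  apply: measurable_funM; first by apply: measurable_indic; exact: measurable_disk.
  by apply: measurable_funB; [exact: measurable_cst|exact: measurable_disk_log].
pose I : set (measurableTypeR R) := `[0, 2 * pi]%classic.
pose rt (t : R) p : plane := rot (cos t) (sin t) p.
(* [h] at the point turned by the angle [q.1], with the uniform probability density on angles. The
   two orders of integration give the two sides. *)
pose K (q : measurableTypeR R * plane) : \bar R :=
  ((2 * pi)^-1 * (\1_I q.1 * h (rt q.1 q.2)))%:E.
have mrt : measurable_fun [set: measurableTypeR R * plane] (fun q => rt q.1 q.2).
  have mc : measurable_fun [set: measurableTypeR R * plane] (fun q => cos q.1).
    by apply: (measurableT_comp (continuous_measurable_fun (@continuous_cos R))); exact: measurable_fst.
  have ms : measurable_fun [set: measurableTypeR R * plane] (fun q => sin q.1).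
    by apply: (measurableT_comp (continuous_measurable_fun (@continuous_sin R))); exact: measurable_fst.
  have m1 : measurable_fun [set: measurableTypeR R * plane] (fun q => q.2.1).
    exact: measurableT_comp measurable_fst measurable_snd.
  have m2 : measurable_fun [set: measurableTypeR R * plane] (fun q => q.2.2).
    exact: measurableT_comp measurable_snd measurable_snd.
  apply: measurable_fun_pair; rewrite /rot/=.
    by apply: measurable_funB; exact: measurable_funM.
  by apply: measurable_funD; exact: measurable_funM.
have mI : measurable I by exact: measurable_itv.
have twopi : 0 < 2 * pi :> R by rewrite mulr_gt0// pi_gt0.
have K0 q : (0 <= K q)%E.
  by rewrite lee_fin mulr_ge0 ?invr_ge0 ?(ltW twopi)// mulr_ge0.
have mK : measurable_fun setT K.
  apply/measurable_EFinP; apply: measurable_funM; first exact: measurable_cst.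
  apply: measurable_funM; last exact: measurableT_comp mh mrt.
  by apply: (measurableT_comp _ measurable_fst); exact: measurable_indic.
have swap : (\int[mu]_t \int[mu2]_p K (t, p) = \int[mu2]_p \int[mu]_t K (t, p))%E :=
  @fubini_tonelli _ _ _ _ R mu area K mK K0.
move: swap.
(* Over the plane first: rotation invariance removes the angle, and the density has total mass 1. *)
have -> : (\int[mu]_t \int[mu2]_p K (t, p) = \int[mu2]_p (h p)%:E)%E.
  transitivity (\int[mu]_t (((2 * pi)^-1 * \1_I t)%:E * \int[mu2]_p (h p)%:E))%E.
    apply: eq_integral => t _; rewrite /K/=.
    rewrite -(@ge0_integral_rot R (cos t) (sin t) (EFin \o h)) ?cos2Dsin2//; last first.
      by apply/measurable_EFinP.
    rewrite -ge0_integralZl//.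
    - by apply: eq_integral => p _; rewrite -EFinM mulrA.
    - apply/measurable_EFinP; apply: (measurableT_comp mh); exact: measurable_rot.
    - by move=> p _; rewrite lee_fin.
    - by rewrite lee_fin mulr_ge0// invr_ge0 ltW.
  rewrite ge0_integralZr//.
  - under eq_integral do rewrite mulrC.
    rewrite -integral_indicM.
    by rewrite integral_cst// [X in (_ * X * _)%E]circle_measure -EFinM mulVf ?gt_eqF// mul1e.
  - apply/measurable_EFinP; apply: measurable_funM; first exact: measurable_cst.
    exact: measurable_indic.
  - by move=> t _; rewrite lee_fin mulr_ge0// invr_ge0 ltW.
  - by apply: integral_ge0 => p _; rewrite lee_fin.
rewrite /h => ->; apply: eq_integral => p _; rewrite /K/=.
(* Over the angle first: turning the point multiplies it by [e^(it)], which keeps it in or out of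
   the disk and turns [disk_log] into [circle_log]. *)
have [i1 i2] := jensen (w * (p.1 +i* p.2)).
transitivity (\int[mu]_(t in I) ((2 * pi)^-1 * \1_(disk 1) p *
    (bound w - circle_log (w * (p.1 +i* p.2)) t))%:E)%E.
  rewrite [RHS]integral_indicM; apply: eq_integral => t _; congr EFin; rewrite /h.
  have -> : \1_(disk 1) (rt t p) = \1_(disk 1) p :> R.
    by apply: eq_indic; rewrite /disk/= rot_expi modulusM modulus_expi mulr1.
  have -> : disk_log w (rt t p) = circle_log (w * (p.1 +i* p.2)) t.
    by rewrite /disk_log /rt rot_expi mulrA.
  by rewrite mulrCA -!mulrA.
have iC : mu.-integrable I (EFin \o (fun=> bound w)).
  by apply: (@integrable_bounded_itv _ _ _ _ `|bound w|).
have iB := integrable_EFinB mI iC i1.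
have iZ : mu.-integrable I (EFin \o (fun t => (2 * pi)^-1 * \1_(disk 1) p *
    (bound w - circle_log (w * (p.1 +i* p.2)) t))).
  exact: (integrableZl mI _ iB).
rewrite -[LHS]fineK; last exact: (integrable_fin_num mI iZ).
congr EFin; rewrite -/(Rintegral _ _ _).
rewrite (RintegralZl _ mI iB) (RintegralB mI iC i1) Rintegral_cst//.
rewrite [X in fine X]circle_measure i2 modulusM -/(plane_modulus p) -/(lnp _)/=.
by rewrite [bound w * _]mulrC -mulrBr mulrACA mulVf ?mul1r ?lt0r_neq0.
Qed.

(** For [0 <= t <= u], the part of the disk where [log^+ (|w| |z|) > t] lies in the annulus
    [r <= |z| < 1] with [r = e^(t - u)]; its area [pi (1 - r^2)] is at most [2 pi (u - t)] by
    [e^x >= 1 + x]. *)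
Lemma integral_lnp_disk w :
  (\int[mu2]_(p in disk 1) (lnp (modulus w * plane_modulus p))%:E <=
   (pi * lnp (modulus w) ^+ 2)%:E)%E.
Proof.
set u := lnp (modulus w).
have [u0|u0] := eqVneq u 0.
  rewrite u0 expr0n/= mulr0 (eq_integral (cst 0%E)); first by rewrite integral0.
  move=> p /[!inE] Dp; congr EFin; apply/eqP.
  by rewrite eq_le lnp_ge0 andbT -u0 lnp_le.
have {}u0 : 0 < u by rewrite lt_neqAle eq_sym u0 lnp_ge0.
have uE : u = ln (modulus w).
  by move: u0; rewrite /u /lnp /Num.max; case: ifP => // _; rewrite ltxx.
have w0 : 0 < modulus w.
  by rewrite ltNge; apply/negP => h; move: u0; rewrite uE ln0// ltxx.
pose k p := lnp (modulus w * plane_modulus p).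
(* The region under the graph of [k] over the disk: the section at [p] has length [k p], the section
   at height [t] is a superlevel set of [k]. *)
pose E : set (measurableTypeR R * plane) :=
  [set q | [/\ 0 <= q.1, disk 1 q.2 & q.1 < k q.2]].
have mE : measurable E.
  have -> : E = (setT `&` (fun q => q.1) @^-1` `[0, +oo[) `&`
      ((setT `&` (fun q => q.2) @^-1` disk 1) `&`
      (setT `&` (fun q => k q.2 - q.1) @^-1` `]0, +oo[)).
    apply/seteqP; split => q /=; rewrite !in_itv/= !andbT subr_gt0.
      by move=> [? ? ?]; split.
    by move=> [[_ ?] [[_ ?] [_ ?]]]; split.
  apply: measurableI; last apply: measurableI.
  - apply: measurable_fst => //; exact: measurable_itv.
  - apply: measurable_snd => //; exact: measurable_disk.
  - have mkq : measurable_fun setT (fun q : measurableTypeR R * plane => k q.2 - q.1).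
      apply: measurable_funB; last exact: measurable_fst.
      exact: measurableT_comp (measurable_lnp_plane w) measurable_snd.
    by apply: mkq => //; exact: measurable_itv.
have mf : measurable_fun setT (fun q => (\1_E q)%:E : \bar R).
  by apply/measurable_EFinP; exact: measurable_indic.
have f0 q : (0 <= (\1_E q)%:E :> \bar R)%E by rewrite lee_fin.
have swap : (\int[mu]_t \int[mu2]_p (\1_E (t, p))%:E =
    \int[mu2]_p \int[mu]_t (\1_E (t, p))%:E)%E :=
  @fubini_tonelli _ _ _ _ R mu area _ mf f0.
rewrite integral_indicM.
rewrite (eq_integral (fun p => \int[mu]_t (\1_E (t, p))%:E))%E; last first.
  move=> p _.
  have kp : ([set t | E (t, p)] = if p \in disk 1 then `[0, k p[%classic else set0 :> set R).
    case: ifPn => [|]; rewrite ?notin_setE ?inE => Dp.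
      apply/seteqP; split => t; rewrite /E/= in_itv/=; first by move=> [-> _ ->].
      by move=> /andP[]; split.
    by apply/seteqP; split => t //; rewrite /E/= => -[].
  rewrite (eq_integral (fun t => (\1_[set t | E (t, p)] t)%:E)); last first.
    by move=> t _; congr EFin; exact: eq_indic.
  rewrite kp indicE; case: (boolP (p \in disk 1)) => Dp.
    rewrite integral_indic//= setIT lebesgue_measure_itv/= lte_fin mul1r.
    have := lnp_ge0 (modulus w * plane_modulus p); rewrite -/(k p) le_eqVlt.
    by case/predU1P => [<-|->]; rewrite ?ltxx// sube0.
  by rewrite integral_indic// set0I measure0 mul0r.
rewrite -swap.
apply: (@le_trans _ _ (\int[mu]_(t in `[0%R, u]) (2 * pi * (u - t))%:E)%E).
  rewrite [leRHS]integral_indicM.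
  apply: ge0_le_integral => //.
  - by move=> t _; exact: integral_ge0.
  - exact: (@measurable_fun_fubini_tonelli_F _ _ _ _ R area _ mf f0).
  - apply/measurable_EFinP; apply: measurable_funM.
      by apply: measurable_indic; exact: measurable_itv.
    apply: measurable_funM; first exact: measurable_cst.
    by apply: measurable_funB => //; exact: measurable_cst.
  move=> t _; rewrite indicE mem_setE in_itv/=.
  rewrite (eq_integral (fun p => (\1_[set p | E (t, p)] p)%:E)); last first.
    by move=> p _; congr EFin; exact: eq_indic.
  have [/andP[t0 tu]|tn] := boolP (0 <= t <= u); last first.
    rewrite mul0r (_ : [set p | E (t, p)] = set0) ?indic0 ?integral0//.
    apply/seteqP; split => p //; rewrite /E/= => -[t0 Dp tk]; move/negP: tn; apply.
    by rewrite t0/= (le_trans (ltW tk))// lnp_le.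
  pose r := expR (t - u).
  have r0 : 0 < r by exact: expR_gt0.
  have mEt : measurable [set p | E (t, p)].
    rewrite (_ : [set p | E (t, p)] = xsection E t); first exact: measurable_xsection.
    by apply/seteqP; split => p; rewrite /xsection/= inE.
  rewrite mul1r integral_indic// setIT.
  apply: (@le_trans _ _ (mu2 (disk 1 `\` disk r))).
    rewrite le_measure ?inE//; first by apply: measurableD; exact: measurable_disk.
    move=> p; rewrite /E/= => -[_ Dp tk]; split => //; rewrite /disk/= => pr.
    move: tk; rewrite /k /lnp; apply/negP; rewrite -leNgt ge_max t0/=.
    (* At the origin [ln 0 = 0 <= t]; elsewhere the logarithm of the product splits. *)
    have [->|p0] := eqVneq (plane_modulus p) 0; first by rewrite mulr0 ln0.
    have {}p0 : 0 < plane_modulus p by rewrite lt_neqAle eq_sym p0 plane_modulus_ge0.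
    rewrite lnM ?posrE// -uE addrC -lerBrDr -[leRHS]expRK ler_ln ?posrE//.
    exact: ltW.
  have r1 : r <= 1 by rewrite -expR0 ler_expR subr_le0.
  have mD1 := @measurable_disk R 1; have mDr := @measurable_disk R r.
  rewrite measureD//=; last by rewrite area_disk// ltry.
  rewrite (_ : disk 1 `&` disk r = disk r); last first.
    by apply/seteqP; split => p /=; [case|move=> pr; split => //; exact: lt_le_trans pr r1].
  rewrite !area_disk// -EFinB lee_fin expr1n -mulrBr mulrAC mulrC.
  rewrite ler_pM2r ?pi_gt0//.
  have := expR_ge1Dx ((t - u) + (t - u)); rewrite expRD -/r -expr2; lra.
have ck : continuous (fun t : R => 2 * pi * (u - t)).
  by move=> t; apply: cvgMr; apply: cvgB; [exact: cvg_cst|exact: cvg_id].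
have dK (t : R) : is_derive t 1 (fun t : R => - pi * ((u - t) * (u - t))) (2 * pi * (u - t)).
  rewrite (_ : 2 * _ * _ = - pi *: ((u - t) *: (0 - 1) + (u - t) *: (0 - 1))).
    by apply: is_deriveZ; apply: is_deriveM.
  by rewrite /GRing.scale/=; ring.
rewrite (integral_FTC u0 ck dK) lee_fin.
by rewrite le_eqVlt; apply/orP; left; apply/eqP; ring.
Qed.

(** The functions [bound w - disk_log w] and [bound w - log^+ (|w| |z|)] have the same finite
    integral, so [disk_log w] is integrable and the constant cancels. *)
Lemma disk_log_integral w :
  mu2.-integrable (disk 1) (EFin \o disk_log w) /\
  \int[mu2]_(p in disk 1) disk_log w p <= pi * lnp (modulus w) ^+ 2.
Proof.
have mD := @measurable_disk R 1.
have aD : (mu2 (disk 1) = pi%:E)%E by rewrite area_disk// expr1n mulr1.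
have Dy : (mu2 (disk 1) < +oo)%E by rewrite aD ltry.
pose k p := lnp (modulus w * plane_modulus p).
have ik : mu2.-integrable (disk 1) (EFin \o k).
  apply: measurable_bounded_integrable => //.
    by apply: measurable_funTS; exact: measurable_lnp_plane.
  exists (lnp (modulus w)); split; first exact: num_real.
  move=> M uM p Dp; rewrite /= ger0_norm ?lnp_ge0//.
  exact: le_trans (lnp_le w Dp) (ltW uM).
have ic : mu2.-integrable (disk 1) (EFin \o (fun=> bound w)).
  apply: measurable_bounded_integrable => //.
  by exists `|bound w|; split; [exact: num_real|move=> M CM x _; exact: ltW].
have [] := @integrable_of_bounded_above R _ _ mu2 (disk 1) (disk_log w) (bound w)
  (bound w * pi - \int[mu2]_(p in disk 1) k p).
- exact: mD.
- exact: Dy.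
- by apply: measurable_funTS; exact: measurable_disk_log.
- by move=> p; exact: disk_log_le.
- rewrite disk_log_average -[LHS]fineK; last first.
    exact: (integrable_fin_num mD (integrable_EFinB mD ic ik)).
  congr EFin; rewrite -/(Rintegral _ _ _) (RintegralB mD ic ik) Rintegral_cst//.
  by rewrite [X in fine X]aD.
move=> idl ->; split => //.
rewrite [X in fine X]aD/= subKr -lee_fin fineK; last exact: (integrable_fin_num mD ik).
exact: integral_lnp_disk.
Qed.

End disk_average.

(** * Polynomials *)

Section log_product.
Context {R : realType} d (T : measurableType d) (mu : {measure set T -> \bar R}).
(** Two instances are intended: the circle, with [phi = expi], and the unit disk, with [phi] the
    identification of the plane with [R[i]]. *)
Variables (D : set T) (phi : T -> R[i]).
Hypotheses (mD : measurable D) (mphi : cmeasurable phi).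
Hypothesis fiber_null : forall w, mu.-negligible (D `&` [set x | phi x = w]).
Hypothesis ilog : forall w,
  mu.-integrable D (EFin \o (fun x => ln (modulus (1 - w * phi x)))).

Let prod (s : seq R[i]) x := \prod_(w <- s) (1 - w * phi x).

Let cmeasurable_prod s : cmeasurable (prod s).
Proof.
elim: s => [|w s IH].
  rewrite (_ : prod [::] = (fun=> 1)); first exact: cmeasurable_cst.
  by apply/funext => x; rewrite /prod big_nil.
rewrite (_ : prod (w :: s) = (fun x => (1 - w * phi x) * prod s x)); last first.
  by apply/funext => x; rewrite /prod big_cons.
apply: cmeasurableM => //; apply: cmeasurableB; first exact: cmeasurable_cst.
by apply: cmeasurableM => //; exact: cmeasurable_cst.
Qed.

(** A zero of the product is a zero of some [1 - w * phi x]; then [w != 0] and [x] lies in the null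
    fiber over [w^-1]. *)
Let prod_null s : mu.-negligible (D `&` [set x | prod s x = 0]).
Proof.
elim: s => [|w s IH].
  apply: (negligibleS _ (negligible_set0 mu)) => x [_] /=.
  by rewrite /prod big_nil => /eqP; rewrite oner_eq0.
apply: (negligibleS _ (negligibleU (fiber_null w^-1) IH)) => x [Dx] /=.
rewrite /prod big_cons => /eqP; rewrite mulf_eq0 => /orP[|/eqP]; last by right.
rewrite subr_eq0 => /eqP e; left; split => //=.
have w0 : w != 0 by apply/eqP => w0; move: e; rewrite w0 mul0r => /eqP; rewrite oner_eq0.
by apply: (mulfI w0); rewrite -e divff.
Qed.

(* The convention [ln 0 = 0] makes [ln] additive on products only off their
   zeros. *)
Lemma integral_log_prod (s : seq R[i]) :
  mu.-integrable D (EFin \o (fun x => ln (modulus (\prod_(w <- s) (1 - w * phi x))))) /\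
  \int[mu]_(x in D) ln (modulus (\prod_(w <- s) (1 - w * phi x))) =
  \sum_(w <- s) \int[mu]_(x in D) ln (modulus (1 - w * phi x)).
Proof.
have mlog s' : measurable_fun D (EFin \o (fun x => ln (modulus (prod s' x)))).
  apply/measurable_EFinP; apply: measurable_funTS; apply: measurable_ln_modulus.
  exact: cmeasurable_prod.
elim: s => [|w s [IH1 IH2]].
  have e x : ln (modulus (\prod_(w <- [::]) (1 - w * phi x))) = 0 :> R.
    by rewrite big_nil modulus1 ln1.
  split.
    rewrite (_ : _ \o _ = cst 0%E); first exact: integrable0.
    by apply/funext => x /=; rewrite e.
  rewrite [RHS]big_nil (@eq_Rintegral _ _ _ mu D (fun=> 0)); last by move=> x _; exact: e.
  by rewrite Rintegral_cst// mul0r.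
pose g x := ln (modulus (1 - w * phi x)) + ln (modulus (prod s x)).
have ig : mu.-integrable D (EFin \o g) by exact: (integrableD mD (ilog w) IH1).
have mg : measurable_fun D (EFin \o g) by have /integrableP[] := ig.
have ae : ae_eq mu D (EFin \o g) (EFin \o (fun x => ln (modulus (prod (w :: s) x)))).
  have [N [mN N0 sN]] := negligibleU (prod_null [:: w]) (prod_null s).
  exists N; split => // x /= /not_implyP[Dx ne]; apply: sN; apply: contrapT => /not_orP[n1 n2].
  apply: ne; congr EFin; rewrite /g {2}/prod big_cons -/(prod s x) modulusM.
  rewrite lnM// posrE modulus_gt0; apply/eqP => e.
    by apply: n1; split => //=; rewrite /prod big_seq1.
  by apply: n2; split.
have e : (\int[mu]_(x in D) (ln (modulus (prod (w :: s) x)))%:E =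
    \int[mu]_(x in D) (g x)%:E)%E.
  by apply/esym; apply: ae_eq_integral => //; exact: mlog.
split.
  apply/integrableP; split; first exact: mlog.
  have -> : (\int[mu]_(x in D) `|(EFin \o (fun x => ln (modulus (prod (w :: s) x)))) x| =
      \int[mu]_(x in D) `|(EFin \o g) x|)%E.
    apply/esym; apply: ae_eq_integral => //.
    - exact: measurableT_comp.
    - by apply: measurableT_comp => //; exact: mlog.
    - exact: ae_eq_abse.
  by have /integrableP[] := ig.
rewrite big_cons -IH2 -RintegralD//.
by rewrite /Rintegral e.
Qed.

End log_product.

Section factorisation.
Context {R : realType}.
Local Open Scope complex_scope.

(** As [P(0) != 0], no root [a] is zero, and [z - a = - a (1 - z / a)] gives
    [P(z) = P(0) prod (1 - z / a)]; the list consists of the inverses of the roots with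
    multiplicity. *)
Lemma poly_log_factor (P : {poly R[i]}) : modulus P.[0] = 1 ->
  exists s : seq R[i], forall z, modulus P.[z] = modulus (\prod_(w <- s) (1 - w * z)).
Proof.
move=> P0.
have [r Pr] := closed_field_poly_normal P.
have Pz z : P.[z] = lead_coef P * \prod_(a <- r) (z - a).
  rewrite [in LHS]Pr hornerZ horner_prod; congr (_ * _).
  by apply: eq_bigr => a _; rewrite hornerXsubC.
have r0 a : a \in r -> a != 0.
  move=> ar; apply/eqP => a0; move: P0.
  rewrite Pz (big_rem a)//= a0 subrr mul0r mulr0 modulus0 => /eqP.
  by rewrite eq_sym oner_eq0.
exists [seq a^-1 | a <- r] => z.
rewrite big_map.
have -> : P.[z] = P.[0] * \prod_(a <- r) (1 - a^-1 * z).
  rewrite !Pz -mulrA -big_split/=; congr (_ * _).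
  rewrite big_seq [RHS]big_seq; apply: eq_bigr => a ar.
  by rewrite sub0r mulrBr mulr1 mulNr opprK mulrA divff ?r0// mul1r addrC.
by rewrite modulusM P0 mul1r.
Qed.

End factorisation.

(** * Null fibers and the assembly over all factors *)

Section mahler_bounds.
Context {R : realType}.
Local Notation mu := (@lebesgue_measure R).
Local Notation mu2 := (mu \x mu)%E.
Local Open Scope complex_scope.

Lemma circle_fiber_null (w : R[i]) :
  mu.-negligible (`[0, 2 * pi] `&` [set t | expi t = w]).
Proof.
exists (expi_fiber w); split.
- exact: measurable_expi_fiber.
- exact: expi_fiber_null.
- by move=> t [] /=; rewrite in_itv/=; exact: expi_fiberP.
Qed.

Lemma plane_fiber_null (w : R[i]) :
  mu2.-negligible (disk 1 `&` [set p | p.1 +i* p.2 = w]).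
Proof.
exists ([set Re w] `*` [set Im w]); split.
- by apply: measurableX; exact: measurable_set1.
- by rewrite [LHS]product_measure1E//= ?lebesgue_measure_set1 ?mul0e.
- by move=> p [_ /= <-].
Qed.

Lemma sumr_sqr_le (s : seq R[i]) (u : R[i] -> R) : (forall w, 0 <= u w) ->
  \sum_(w <- s) u w ^+ 2 <= (\sum_(w <- s) u w) ^+ 2.
Proof.
move=> u0; elim: s => [|w s IH]; first by rewrite !big_nil expr0n.
rewrite !big_cons sqrrD.
have : 0 <= u w * \sum_(w0 <- s) u w0 by rewrite mulr_ge0// sumr_ge0.
by rewrite -mulr_natl; lra.
Qed.

End mahler_bounds.

Theorem theorem1p1 (R : realType) (P : {poly R[i]}) (hP0 : `|P.[0]| = 1) :
  log_areal_mahler P <= log_mahler P ^+ 2.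
Proof.
have P0 : modulus P.[0] = 1 by move: hP0; rewrite normc_modulus => -[].
have [s Ps] := poly_log_factor P0.
have pi0 := pi_gt0 R.
pose u (w : R[i]) := lnp (modulus w).
(* Jensen's formula applied factor by factor. *)
have -> : log_mahler P = \sum_(w <- s) u w.
  rewrite /log_mahler; under eq_Rintegral do rewrite Ps.
  have mI : measurable (`[0, 2 * pi]%classic : set (measurableTypeR R)).
    exact: measurable_itv.
  have [_ ->] := @integral_log_prod R _ _ lebesgue_measure _ expi mI cmeasurable_expi
    (@circle_fiber_null R) (fun w => (jensen w).1) s.
  rewrite mulr_sumr; apply: eq_bigr => w _.
  have [_ e] := jensen w; rewrite e mulKf//.
  by rewrite lt0r_neq0// mulr_gt0.
(* Passing to the sum of squares leaves one inequality for each factor. *)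
apply: le_trans (sumr_sqr_le s (fun w => lnp_ge0 (modulus w))).
rewrite /log_areal_mahler; under eq_Rintegral do rewrite Ps.
have [_ ->] := @integral_log_prod R _ _ (lebesgue_measure \x lebesgue_measure)%E _ _
    (@measurable_disk R 1) (@cmeasurable_plane R)
    (@plane_fiber_null R) (fun w => (disk_log_integral w).1) s.
rewrite mulr_sumr; apply: ler_sum => w _.
rewrite mulrC ler_pdivrMr// mulrC.
exact: (disk_log_integral w).2.
Qed.
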